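(* Let $G$ be a group, $R$ a commutative $G$-graded ring with nonzero unity, and $M$ a nonzero $G$-graded $R$-module. If $\{0\}$ is the only graded special $r$-submodule of $M$ and $M$ is homogeneous faithful, then $M$ is homogeneous torsion free.
   Context: A commutative ring $R$ is $G$-graded if $R=\bigoplus_{g\in G}R_g$ with additive subgroups $R_g$ satisfying $R_gR_h\subseteq R_{gh}$; an $R$-module $M$ is $G$-graded if $M=\bigoplus_{g\in G}M_g$ with additive subgroups $M_g$ satisfying $R_gM_h\subseteq M_{gh}$. Put $h(R)=\bigcup_{g\in G}R_g$ and $h(M)=\bigcup_{g\in G}M_g$. An $R$-submodule $K$ of $M$ is graded if $K=\bigoplus_{g\in G}(K\cap M_g)$. Notation: $(K:_R M)=\{r\in R: rM\subseteq K\}$; $Ann_R(x)=\{r\in R: rx=0\}$ for $x\in M$. A proper graded $R$-submodule $K$ of $M$ is a graded special $r$-submodule if whenever $a\in h(R)$ and $x\in h(M)$ satisfy $ax\in K$ and $Ann_R(x)=\{0\}$, then $a\in(K:_R M)$. $M$ is homogeneous faithful if $rM\neq\{0\}$ for all $0\neq r\in h(R)$. $M$ is homogeneous torsion free if whenever $r\in h(R)$ and $x\in h(M)$ satisfy $rx=0$, then $r=0$ or $x=0$. *)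

(* Defs.v *)
From HB Require Import structures.
From mathcomp Require Import all_boot all_order all_algebra.
From mathcomp Require Export classical_sets.
From mathcomp Require Import boolp functions cardinality fsbigop.

Set Implicit Arguments.
Unset Strict Implicit.
Unset Printing Implicit Defensive.

Import GRing.Theory.
Local Open Scope classical_set_scope.
Local Open Scope ring_scope.

Section DirectSum.
Variables (I : choiceType) (V : zmodType).

(* The external direct sum of the A i, as the finitely supported families. *)
Definition dsum_families (A : I -> set V) : set (I -> V) :=
  [set f | (forall i, A i (f i)) /\ finite_set [set i | f i != 0]].

(* S is the internal direct sum of the A i: every element of S is a finite sum
   of elements of the A i in exactly one way, and all such sums are in S.
   The side condition on the support matters: the sum below is 0 by
   convention when f has infinite support. *)
Definition is_direct_sum (A : I -> set V) (S : set V) : Prop :=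
  set_bij (dsum_families A) S (fun f : I -> V => \sum_(i \in [set: I]) f i).

End DirectSum.

Definition graded_ring (G : groupType) (R : comNzRingType)
    (Rg : G -> set R) : Prop :=
  [/\ forall g, GRing.zmod_closed [in Rg g],
      is_direct_sum Rg [set: R]
    & forall (g h : G) (a b : R), Rg g a -> Rg h b -> Rg (g * h)%g (a * b)].

Definition graded_module (G : groupType) (R : comNzRingType) (M : lmodType R)
    (Rg : G -> set R) (Mg : G -> set M) : Prop :=
  [/\ forall g, GRing.zmod_closed [in Mg g],
      is_direct_sum Mg [set: M]
    & forall (g h : G) (a : R) (x : M),
        Rg g a -> Mg h x -> Mg (g * h)%g (a *: x)].

Definition homog (G : Type) (V : Type) (A : G -> set V) : set V :=
  \bigcup_(g in [set: G]) A g.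

Definition graded_submodule (G : groupType) (R : comNzRingType)
    (M : lmodType R) (Mg : G -> set M) (K : set M) : Prop :=
  GRing.submod_closed [in K] /\ is_direct_sum (fun g => K `&` Mg g) K.

Section ModuleNotions.
Variables (R : comNzRingType) (M : lmodType R).

Definition smul_image (r : R) : set M := [set r *: m | m in [set: M]].

Definition colon (K : set M) : set R := [set r | smul_image r `<=` K].

Definition Ann (x : M) : set R := [set r | r *: x = 0].

End ModuleNotions.

Arguments smul_image {R} M r.

Section GradedNotions.
Variables (G : groupType) (R : comNzRingType) (M : lmodType R).
Variables (Rg : G -> set R) (Mg : G -> set M).

Definition graded_special_r_submodule (K : set M) : Prop :=
  [/\ graded_submodule Mg K,
      K <> [set: M]
    & forall (a : R) (x : M), homog Rg a -> homog Mg x ->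
        K (a *: x) -> Ann x = [set 0] -> colon K a].

Definition homogeneous_faithful : Prop :=
  forall r : R, homog Rg r -> r <> 0 -> smul_image M r <> [set 0].

Definition homogeneous_torsion_free : Prop :=
  forall (r : R) (x : M), homog Rg r -> homog Mg x ->
    r *: x = 0 -> r = 0 \/ x = 0.

End GradedNotions.

Arguments homogeneous_faithful {G R} M Rg.

(* Main.v *)
Require Import Defs.
From mathcomp Require Import all_boot all_order all_algebra.
From mathcomp Require Import classical_sets.
From mathcomp Require Import finmap boolp cardinality fsbigop.

(** Let [r] be a nonzero homogeneous scalar and let [K] be the submodule of the
    elements killed by [r].  The theorem follows once [K] is recognised as a
    graded special r-submodule: it must then be zero, so [r *: x = 0] forces
    [x = 0].

    - [K] is graded.  Multiplication by [r], of degree [g], sends the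
      degree-[h] component of [m] into degree [g * h].  Since [h |-> g * h] is
      injective, distinct components land in distinct degrees, and uniqueness
      of the decomposition of [r *: m = 0] kills every [r *: m_h]
      ([homog_scale_components_eq0]).
    - [K] is proper, because [K = M] would mean [rM = 0], which homogeneous
      faithfulness excludes.
    - [K] has the r-property: if [a *: x] is in [K] then [r * a] annihilates
      [x]; when [Ann x = 0] this gives [r * a = 0], so [aM] lies in [K]. *)

Import GRing.Theory.
Local Open Scope classical_set_scope.
Local Open Scope ring_scope.

Lemma scaler_fsumr (R : nzRingType) (V : lmodType R) (I : choiceType) (a : R)
    (f : I -> V) (f_fin : finite_set [set i | f i != 0]) :
  a *: (\sum_(i \in [set: I]) f i) = \sum_(i \in [set: I]) a *: f i.
Proof.
have f0 i : i \notin fset_set [set i | f i != 0] -> f i = 0.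
  by rewrite in_fset_set // notin_setE => /negP/negPn/eqP.
rewrite !(fsbigTE (fset_set [set i | f i != 0])) //.
  by rewrite scaler_sumr.
by move=> i /f0 ->; rewrite scaler0.
Qed.

(** A submodule need only contain the homogeneous components of its elements:
    uniqueness of the decomposition is inherited from [M], and finite sums
    stay inside the submodule. *)
Lemma graded_submodule_of_components (G : groupType) (R : comNzRingType)
    (M : lmodType R) (Mg : G -> set M) (K : set M) :
  is_direct_sum Mg [set: M] -> GRing.submod_closed [in K] ->
  (forall f, dsum_families Mg f -> K (\sum_(h \in [set: G]) f h) ->
     forall h, K (f h)) ->
  graded_submodule Mg K.
Proof.
move=> [_ inj surj] Ksub Kcomp; split=> //.
have sub_fam f : dsum_families (fun g => K `&` Mg g) f -> dsum_families Mg f.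
  by case=> fK ffin; split=> // h; case: (fK h).
have [K0 _] := Ksub.
have KD (x y : M) : K x -> K y -> K (x + y).
  move=> /mem_set Kx /mem_set Ky; rewrite -[x]scale1r.
  by apply: set_mem; apply: Ksub.2.
split.
- move=> f [fK _]; elim/big_ind: _ => [|x y|h _]; first exact: set_mem.
  + exact: KD.
  + by case: (fK h).
- move=> f f' /set_mem/sub_fam fM /set_mem/sub_fam f'M.
  by apply: inj; apply: mem_set.
- move=> m Km; have [f fM fm] := surj m I; exists f => //.
  case: (fM) => fMg ffin; split=> // h; split=> //.
  by apply: Kcomp => //; rewrite fm.
Qed.

(** Left translation by the degree [g] of [r] is a bijection of [G], so the
    [r *: f h], reindexed by [g * h], form the homogeneous decomposition of
    [0]; by uniqueness that decomposition is the zero family. *)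
Lemma homog_scale_components_eq0 {G : groupType} {R : comNzRingType}
    {Rg : G -> set R} {M : lmodType R} {Mg : G -> set M}
    (HM : graded_module Rg Mg) {r : R} {f : G -> M} :
  homog Rg r -> dsum_families Mg f -> r *: (\sum_(h \in [set: G]) f h) = 0 ->
  forall h, r *: f h = 0.
Proof.
move=> [g _ Rr] [fMg ffin]; rewrite scaler_fsumr // => rf0 h.
have [Mzmod [_ inj _] scaleMg] := HM.
(* The component of [r *: m] in degree [k] comes from degree [g^-1 * k] of
   [m]. *)
pose rf k := r *: f (g^-1 * k)%g.
have rf_fam : dsum_families Mg rf.
  split=> [k|]; first by rewrite -[k in Mg k](mulVKg g); apply: scaleMg.
  apply: sub_finite_set (finite_image (fun h => (g * h)%g) ffin) => k /= rfk.
  exists (g^-1 * k)%g; last exact: mulVKg.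
  by apply: contra_neq rfk; rewrite /rf => ->; rewrite scaler0.
have zero_fam : dsum_families Mg (fun _ => 0).
  split=> [k|]; first by apply: set_mem; case: (Mzmod k).
  by apply: sub_finite_set (finite_set0 G) => k /=; rewrite eqxx.
have rf_sum0 : \sum_(k \in [set: G]) rf k = \sum_(k \in [set: G]) (0 : M).
  rewrite (reindex_fsbigT (fun h => (g * h)%g)); last first.
    by exists (fun k => (g^-1 * k)%g) => k; rewrite ?mulKg ?mulVKg.
  rewrite [RHS]fsbig1 // -[RHS]rf0; apply: eq_fsbigr => k _.
  by rewrite /rf mulKg.
have /(congr1 (fun F => F (g * h)%g)) :=
  inj _ _ (mem_set rf_fam) (mem_set zero_fam) rf_sum0.
by rewrite /rf mulKg.
Qed.

(** The r-property comes from commutativity: [r *: (a *: x) = 0] places [r * a]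
    in [Ann x], and once [r * a = 0] the whole of [aM] is killed by [r]. *)
Lemma killed_by_homog_graded_special {G : groupType} {R : comNzRingType}
    {Rg : G -> set R} {M : lmodType R} {Mg : G -> set M} {r : R} :
  graded_module Rg Mg -> homog Rg r -> smul_image M r <> [set 0] ->
  graded_special_r_submodule Rg Mg [set m | r *: m = 0].
Proof.
move=> HM Rr rM_neq0; split.
- apply: graded_submodule_of_components; first by have [] := HM.
    split=> [|a x y /set_mem/= rx0 /set_mem/= ry0]; apply: mem_set => /=.
      exact: scaler0.
    by rewrite scalerDr ry0 addr0 scalerA mulrC -scalerA rx0 scaler0.
  by move=> f f_fam /= rf0 h; apply: (homog_scale_components_eq0 HM Rr f_fam rf0).
- move=> K_top; apply: rM_neq0; apply/seteqP; split=> [_ [m _ <-]|_ ->] /=.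
    by have : [set m | r *: m = 0] m by rewrite K_top.
  by exists 0; rewrite ?scaler0.
- move=> a x _ _ /= rax0 Annx0 _ [m _ <-] /=.
  have /= ra0 : [set (0 : R)] (r * a) by rewrite -Annx0 /Ann /= -scalerA.
  by rewrite scalerA ra0 scale0r.
Qed.

Theorem theorem4p22 (G : groupType) (R : comNzRingType) (Rg : G -> set R)
    (M : lmodType R) (Mg : G -> set M)
    (HR : graded_ring Rg) (HM : graded_module Rg Mg)
    (Mnonzero : exists x : M, x <> 0)
    (only0 : forall K : set M,
       graded_special_r_submodule Rg Mg K <-> K = [set 0])
    (Mfaithful : homogeneous_faithful M Rg) :
  homogeneous_torsion_free Rg Mg.
Proof.
move=> r x Rr _ rx0; case: (EM (r = 0)) => [r0|r_neq0]; [by left | right].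
have K_special := killed_by_homog_graded_special HM Rr (Mfaithful r Rr r_neq0).
have K0 := (only0 _).1 K_special.
by have : [set m | r *: m = 0] x by []; rewrite K0.
Qed.
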